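(* For a permutation $\pi$ of $[n]$ let $G_\pi$ be its grid graph (defined in the context), let $\mathrm{Av}_n(213)$ be the set of $213$-avoiding permutations of $[n]$, and let $Q_4(n)=\sum_{\pi\in\mathrm{Av}_n(213)}\#\{v\in V(G_\pi):\deg(v)=4\}$. Then for all $n\ge 2$, \[ Q_4(n)=\frac{4n^3-7n^2+29n-20}{4(n+1)(2n-1)}\binom{2n}{n}-7\cdot 4^{\,n-2}. \]
   Context: The grid graph $G_\pi$ of a permutation $\pi=\pi_1\cdots\pi_n$ of $[n]$ has vertex set $\{(i,j):1\le i\le n,\ 1\le j\le \pi_i\}$; two vertices $(i,j),(i',j')$ are adjacent iff either $i=i'$ and $|j-j'|=1$, or $|i-i'|=1$ and $j=j'$. A permutation avoids $213$ if there are no indices $p<q<r$ with $\pi_q<\pi_p<\pi_r$. *)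

(* Defs.v *)
From mathcomp Require Import all_boot all_order all_fingroup all_algebra.

Set Implicit Arguments.
Unset Strict Implicit.
Unset Printing Implicit Defensive.

(* Indices and values are shifted down by one: a permutation of [n] is
   pi : 'S_n, acting on {0, ..., n-1}, and the paper's pi_(i+1) is (pi i).+1.
   The paper's vertex (i+1, j+1) is encoded as (i, j), so that the condition
   1 <= j+1 <= pi_(i+1) becomes j <= pi i. *)

Definition grid_vertices (n : nat) (pi : 'S_n) : {set 'I_n * 'I_n} :=
  [set v : 'I_n * 'I_n | v.2 <= pi v.1].

Definition grid_adj (n : nat) : rel ('I_n * 'I_n) :=
  fun v w =>
    (v.1 == w.1) && (`|v.2 - w.2|%N == 1)
    || (`|v.1 - w.1|%N == 1) && (v.2 == w.2).

Definition grid_deg (n : nat) (pi : 'S_n) (v : 'I_n * 'I_n) : nat :=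
  #|[set w in grid_vertices pi | grid_adj v w]|.

Definition avoids213 (n : nat) (pi : 'S_n) : bool :=
  ~~ [exists p : 'I_n, exists q : 'I_n, exists r : 'I_n,
        [&& p < q, q < r, pi q < pi p & pi p < pi r]].

Definition Av213 (n : nat) : {set 'S_n} := [set pi | avoids213 pi].

Definition Q4 (n : nat) : nat :=
  \sum_(pi in Av213 n) #|[set v in grid_vertices pi | grid_deg pi v == 4]|.

(* Main.v *)
Require Import Defs.
From mathcomp Require Import all_boot all_order all_fingroup all_algebra.
From mathcomp Require Import zify ring lra.

Set Implicit Arguments.
Unset Strict Implicit.
Unset Printing Implicit Defensive.

(** Write a 213-avoiding word on {0, ..., n} as A 0 B.  Avoidance forces every
letter of A to exceed every letter of B, so such words correspond to pairs of
smaller 213-avoiding words, and they are counted by the Catalan numbers c_n.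
The number of degree-4 vertices is a sum over triples of consecutive letters
a, b, c of min(a, b-1, c); every triple meeting the letter 0 contributes 0, so
the statistic is the sum of its values on the shifted words A and B.  On a word
shifted by one it is sum min(a+1, b, c+1), and each further unit of shift adds
1 per triple.  If X(n) denotes the total of the shifted statistic, then

  Q4(n+1) = 2 sum_p X(p) c_(n-p) + sum_p (n-p) max(p-2,0) c_p c_(n-p),
  X(n) = Q4(n) + max(n-2,0) c_n - #{words in which 0 is neither first nor last},

a linear recurrence for X.  Its solution is a combination of n B_n, B_n, c_n,
B_n/(2n-1) and 4^n, where B_n is the central binomial coefficient, and is checked
using the convolutions of these sequences with c. *)

(** * Sums over triples of consecutive letters *)

Fixpoint triple_sum (m : nat -> nat -> nat -> nat) (w : seq nat) : nat :=
  match w with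
  | a :: w' =>
      (if w' is b :: c :: _ then m a b c else 0) + triple_sum m w'
  | [::] => 0
  end.

Lemma triple_sum_cons3 m a b c w :
  triple_sum m [:: a, b, c & w] = m a b c + triple_sum m [:: b, c & w].
Proof. by []. Qed.

Lemma triple_sum_nth m w :
  triple_sum m w =
  \sum_(i < size w - 2) m (nth 0 w i) (nth 0 w i.+1) (nth 0 w i.+2).
Proof.
elim: w => [|a [|b [|c w]] IH]; rewrite ?big_ord0 //.
rewrite triple_sum_cons3 IH /= !subSS !subn0 [RHS]big_ord_recl; congr (_ + _).
Qed.

(** Every triple that is not inside [s] or inside [t] contains the separating 0, hence contributes
    nothing. *)
Lemma triple_sum_cat0 m s t :
    (forall b c, m 0 b c = 0) -> (forall a c, m a 0 c = 0) ->
    (forall a b, m a b 0 = 0) ->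
  triple_sum m (s ++ 0 :: t) = triple_sum m s + triple_sum m t.
Proof.
move=> m1 m2 m3; elim: s => [|a [|b [|c s]] IH].
- by case: t => [|b [|c t]] //=; rewrite m1.
- by case: t IH => [|b t] // IH; rewrite triple_sum_cons3 IH m2.
- by rewrite triple_sum_cons3 IH m3.
- by rewrite !cat_cons triple_sum_cons3 -!cat_cons IH addnA.
Qed.

Lemma triple_sum_map m f w :
  triple_sum m (map f w) = triple_sum (fun a b c => m (f a) (f b) (f c)) w.
Proof. by elim: w => [|a [|b [|c w]] IH] //; rewrite triple_sum_cons3 -IH. Qed.

Lemma eq_triple_sum m m' w : (forall a b c, m a b c = m' a b c) ->
  triple_sum m w = triple_sum m' w.
Proof.
move=> e; rewrite !triple_sum_nth; exact: eq_bigr.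
Qed.

Lemma triple_sumD m m' w :
  triple_sum (fun a b c => m a b c + m' a b c) w = triple_sum m w + triple_sum m' w.
Proof. by rewrite !triple_sum_nth big_split. Qed.

Lemma triple_sum_const k w : triple_sum (fun _ _ _ => k) w = (size w - 2) * k.
Proof. by rewrite triple_sum_nth sum_nat_const card_ord. Qed.

(* For consecutive entries a, b, c of a permutation of {0, ..., n-1}, the column
   of b contains exactly [min3 a b c] vertices of degree 4. *)
Definition min3 a b c := minn a (minn b.-1 c).
Definition min3S a b c := min3 a.+1 b.+1 c.+1.

(** The correction comes from the truncated predecessor: [b.-1 + 1] is [b] except at [b = 0]. *)
Lemma min3S_eq a b c : min3 a b c + 1 = min3S a b c + (b == 0).
Proof. rewrite /min3S /min3; case: b => [|b] /=; lia. Qed.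

(** * Decomposition of 213-avoiding words at the letter 0 *)

Definition avoids213_seq (w : seq nat) : Prop :=
  forall p q r, p < q -> q < r -> r < size w ->
    ~~ ((nth 0 w q < nth 0 w p) && (nth 0 w p < nth 0 w r)).

(* In a 213-avoiding word, every letter before 0 exceeds every letter after it;
   s and t are the two parts, standardised. *)
Definition join_words (s t : seq nat) :=
  map (addn (size t).+1) s ++ 0 :: map S t.

(** For a word with a single 0, this is 1 or 0 according to whether that 0 is neither first nor
    last. *)
Definition inner_zeros := triple_sum (fun _ b _ => b == 0).

Lemma inner_zeros_cat0 s t : all (leq 1) s -> all (leq 1) t ->
  inner_zeros (s ++ 0 :: t) = (s != [::]) && (t != [::]).
Proof.
rewrite /inner_zeros => s0 t0.
have zpos u : all (leq 1) u -> triple_sum (fun _ b _ => b == 0) u = 0.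
  elim: u => [|a [|b [|c u]] IH] //= /and4P[a0 b0 c0 u0].
  by rewrite /= in IH; rewrite IH ?b0 ?c0 //; case: b b0 {IH}.
elim: s s0 => [|a [|b s] IH] /=.
- move=> _; rewrite zpos //; case: t t0 => [|b [|c t]] //=; case: b => //.
- move=> _; case: t t0 IH => [|b t] //= t0 IH; rewrite IH //.
- move=> /and3P[a0 b0 s0]; rewrite /= in IH; rewrite IH ?b0 //=.
  by case: b b0 {IH} => // b _; case: s s0.
Qed.

(** The letters of [s] are raised by [(size t).+1]. One unit is built into [min3S]; each of the
    other [size t] units adds 1 to each of the [size s - 2] triples, a truncated difference that is
    0 for short [s]. *)
Lemma triple_sum_join s t :
  triple_sum min3 (join_words s t) =
  triple_sum min3S s + size t * (size s - 2) + triple_sum min3S t.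
Proof.
rewrite triple_sum_cat0; last 3 first.
- by move=> b c; rewrite /min3 min0n.
- by move=> a c; rewrite /min3 min0n minn0.
- by move=> a b; rewrite /min3 !minn0.
rewrite !triple_sum_map; congr (_ + _).
rewrite mulnC -triple_sum_const -triple_sumD.
by apply: eq_triple_sum => a b c; rewrite /min3S /min3; lia.
Qed.

Lemma triple_sum_min3S w :
  triple_sum min3 w + (size w - 2) = triple_sum min3S w + inner_zeros w.
Proof.
rewrite -[size w - 2]muln1 -triple_sum_const -!triple_sumD.
exact/eq_triple_sum/min3S_eq.
Qed.

Lemma inner_zeros_join s t :
  inner_zeros (join_words s t) = (s != [::]) && (t != [::]).
Proof.
rewrite inner_zeros_cat0; first by case: s; case: t.
- by apply/allP => x /mapP[y _ ->].
- by apply/allP => x /mapP[y _ ->].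
Qed.

(** In a 213 pattern neither [p] nor [r] can point at the 0, since both carry letters larger than
    another one. If [p] lies before the 0 and [r] after it, the letter at [r] is too small;
    otherwise the pattern lies within one part. *)
Lemma join_avoids s t :
  avoids213_seq s -> avoids213_seq t -> all (gtn (size t)) t ->
  avoids213_seq (join_words s t).
Proof.
move=> As At tlt p q r pq qr; rewrite size_cat /= !size_map => rlt.
have nl k : k < size s -> nth 0 (join_words s t) k = nth 0 s k + (size t).+1.
  by move=> ks; rewrite nth_cat size_map ks (nth_map 0) // addnC.
have n0 : nth 0 (join_words s t) (size s) = 0.
  by rewrite nth_cat size_map ltnn subnn.
have nr k : k < size t -> nth 0 (join_words s t) (size s + k.+1) = (nth 0 t k).+1.
  move=> kt; rewrite nth_cat size_map ltnNge leq_addr addKn /=.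
  by rewrite (nth_map 0).
case: (ltngtP p (size s)) => [ps|sp|->]; last by rewrite n0 ltn0.
- case: (ltngtP r (size s)) => [rs|sr|->]; last by rewrite n0 ltn0 andbF.
    by rewrite !nl ?(ltn_trans qr) //; have := As p q r pq qr rs; lia.
  have [k kE] : exists k, r = size s + k.+1 by exists (r - (size s).+1); lia.
  have kt : k < size t by lia.
  rewrite kE (nl p) // nr //.
  by have /allP/(_ _ (mem_nth 0 kt)) /= := tlt; lia.
- have [k1 e1] : exists k, p = size s + k.+1 by exists (p - (size s).+1); lia.
  have [k2 e2] : exists k, q = size s + k.+1 by exists (q - (size s).+1); lia.
  have [k3 e3] : exists k, r = size s + k.+1 by exists (r - (size s).+1); lia.
  rewrite e1 e2 e3 !nr; [|lia..].
  by have := At k1 k2 k3; lia.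
Qed.

Lemma avoids213_catl s t : avoids213_seq (s ++ t) -> avoids213_seq s.
Proof.
move=> A p q r pq qr rs; have := A p q r pq qr.
rewrite size_cat !nth_cat rs (ltn_trans qr rs) (ltn_trans pq (ltn_trans qr rs)).
by apply; exact: ltn_addr.
Qed.

Lemma avoids213_catr s t : avoids213_seq (s ++ t) -> avoids213_seq t.
Proof.
move=> A p q r pq qr rs.
have := A (size s + p) (size s + q) (size s + r).
by rewrite size_cat !nth_cat !ltnNge !leq_addr /= !addKn -!ltnNge !ltn_add2l; apply.
Qed.

Lemma avoids213_map f s :
  {in s &, {mono f : a b / a < b}} ->
  avoids213_seq (map f s) <-> avoids213_seq s.
Proof.
move=> fm.
have E p q r : p < q -> q < r -> r < size s ->
    (nth 0 (map f s) q < nth 0 (map f s) p < nth 0 (map f s) r) =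
    (nth 0 s q < nth 0 s p < nth 0 s r).
  move=> pq qr rs; have qs := ltn_trans qr rs; have ps := ltn_trans pq qs.
  by rewrite !(nth_map 0) // !fm ?mem_nth.
split=> A p q r pq qr; first by move=> rs; rewrite -E // A // size_map.
by rewrite size_map => rs; rewrite E // A.
Qed.

(** The list 0, sorted [t], sorted [s] is itself sorted, so it equals the [iota]; cutting that after
    the first [(size t).+1] entries gives both claims. *)
Lemma perm_iota_cat0_split s t :
    (forall a b, a \in s -> b \in t -> b < a) ->
    perm_eq (s ++ 0 :: t) (iota 0 (size s + size t).+1) ->
  perm_eq s (iota (size t).+1 (size s)) /\ perm_eq t (iota 1 (size t)).
Proof.
move=> st P.
have E : 0 :: sort leq t ++ sort leq s = iota 0 (size s + size t).+1.
  apply: (sorted_eq leq_trans anti_leq).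
  - rewrite sorted_pairwise ?leq_trans //= ; last exact: leq_trans.
    apply/andP; split; first by apply/allP.
    rewrite pairwise_cat -!sorted_pairwise; try exact: leq_trans.
    rewrite !sort_sorted ?andbT; try exact: leq_total.
    apply/allrelP => b a; rewrite !mem_sort => bt /st/(_ bt).
    exact: ltnW.
  - exact: iota_sorted.
  - apply: perm_trans P; rewrite perm_sym perm_catC /= perm_cons.
    by apply: perm_cat; rewrite perm_sym perm_sort.
move: E; rewrite addnC /= iotaD => -[] /eqP; rewrite eqseq_cat ?size_sort ?size_iota //.
rewrite add1n => /andP[/eqP E1 /eqP E2].
by rewrite -[X in perm_eq _ X]E2 -[X in _ /\ perm_eq _ X]E1 ![perm_eq _ (sort _ _)]perm_sym !perm_sort.
Qed.

Definition av_words n (w : seq nat) := perm_eq w (iota 0 n) /\ avoids213_seq w.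

Lemma av_words_size n w : av_words n w -> size w = n.
Proof. by case=> /perm_size; rewrite size_iota. Qed.

Lemma av_words_join p q s t : av_words p s -> av_words q t ->
  av_words (p + q).+1 (join_words s t).
Proof.
move=> ws wt; have sp := av_words_size ws; have tq := av_words_size wt.
case: ws wt => Ps As [Pt At]; split; last first.
  apply: join_avoids => //; rewrite tq; apply/allP => x.
  by rewrite (perm_mem Pt) mem_iota.
rewrite /join_words tq perm_catC addnC /= iotaD perm_cons.
apply: perm_cat.
  by rewrite -[X in iota X]addn0 iotaDl; apply/perm_map.
by rewrite add1n -[X in iota X]addn0 iotaDl; apply/perm_map.
Qed.

Lemma av_words_split n w : av_words n.+1 w ->
  exists s t, [/\ size s <= n, av_words (size s) s, av_words (n - size s) t
    & w = join_words s t].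
Proof.
move=> [P A].
have w0 : 0 \in w by rewrite (perm_mem P) mem_iota.
have sw : size w = n.+1 by rewrite (perm_size P) size_iota.
have Uw : uniq w by rewrite (perm_uniq P) iota_uniq.
case/splitPr: w0 P A sw Uw => s t P A.
rewrite size_cat /= addnS => -[sw].
rewrite cat_uniq /= => /and3P[_ /norP[s0 /hasPn st] /andP[t0 _]].
(* If [a < b], the letters a, 0, b would form a 213 pattern; [a = b] is excluded by uniqueness. *)
have lt a b : a \in s -> b \in t -> b < a.
  move=> aS bT; case: (ltngtP b a) => // [ab|eab]; last first.
    by have := st _ bT; rewrite eab /= aS.
  have := A (index a s) (size s) (size s + (index b t).+1).
  have ge k : (size s + k < size s) = false by lia.
  rewrite size_cat /= index_mem aS !nth_cat ltnn subnn ge addKn index_mem aS /=.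
  rewrite !nth_index // ab andbT lt0n.
  have hi : index b t < size t by rewrite index_mem.
  move/(_ isT); rewrite ltn_add2l ltnS hi -[X in X < _]addn0 ltn_add2l => /(_ isT isT).
  by rewrite negbK => /eqP a0; rewrite a0 (negPf s0) in aS.
have [] := perm_iota_cat0_split lt; first by rewrite sw.
move=> Ps Pt.
have As := avoids213_catl A.
have At : avoids213_seq t by apply: (avoids213_catr (s := s ++ [:: 0])); rewrite -catA.
set s' := map (subn^~ (size t).+1) s; set t' := map predn t.
have sE : s = map (addn (size t).+1) s'.
  rewrite -map_comp map_id_in // => x.
  by rewrite (perm_mem Ps) mem_iota /= => /andP[h _]; rewrite /= subnKC.
have tE : t = map S t'.
  rewrite -map_comp map_id_in // => x.
  by rewrite (perm_mem Pt) mem_iota /= => /andP[h _]; rewrite /= prednK.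
have ss : size s' = size s by rewrite size_map.
have tt : size t' = size t by rewrite size_map.
exists s', t'; rewrite ss; split.
- by rewrite -sw leq_addr.
- split.
    have := Ps; rewrite -[X in iota X]addn0 iotaDl [X in perm_eq X]sE.
    by move/perm_map_inj; apply; exact: addnI.
  apply/(avoids213_map (f := addn (size t).+1)); last by rewrite -sE.
  by move=> a b _ _; rewrite ltn_add2l.
- rewrite -sw addKn; split.
    have := Pt; rewrite -[X in iota X]addn0 iotaDl [X in perm_eq X]tE.
    by move/perm_map_inj; apply; exact: succn_inj.
  by apply/(avoids213_map (f := S)); last by rewrite -tE.
- by rewrite /join_words tt -sE -tE.
Qed.

(** The position of the only 0 recovers [size s]; the two shifts are then undone. *)
Lemma join_words_inj s t s' t' :
  join_words s t = join_words s' t' -> s = s' /\ t = t'.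
Proof.
have ix u v : index 0 (join_words u v) = size u.
  rewrite index_cat size_map /= addn0.
  by case: ifP => // /mapP[x _]; rewrite addSn.
move=> e; have ss : size s = size s' by rewrite -(ix s t) e ix.
move/eqP: e; rewrite eqseq_cat ?size_map // eqseq_cons eqxx /=.
case/andP=> /eqP es /eqP /(inj_map succn_inj) et; split=> //.
by move: es; rewrite et => /(inj_map (@addnI _)).
Qed.

(** * Permutations as words *)

Definition word n (pi : 'S_n) : seq nat := [seq val (pi i) | i <- enum 'I_n].

Lemma size_word n (pi : 'S_n) : size (word pi) = n.
Proof. by rewrite size_map size_enum_ord. Qed.

Lemma nth_word n (pi : 'S_n) (i : 'I_n) : nth 0 (word pi) i = pi i.
Proof. by rewrite (nth_map i) ?size_enum_ord // nth_ord_enum. Qed.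

Lemma word_inj n : injective (@word n).
Proof.
move=> pi rho e; apply/permP => i; apply/val_inj.
by rewrite /= -!nth_word e.
Qed.

Lemma word_perm n (pi : 'S_n) : perm_eq (word pi) (iota 0 n).
Proof.
rewrite -val_enum_ord /word map_comp perm_map //.
apply: uniq_perm; [|exact: enum_uniq|].
  by rewrite map_inj_uniq ?enum_uniq //; exact: perm_inj.
by move=> i; rewrite mem_enum -[i](permKV pi) map_f ?mem_enum.
Qed.

(** By counting: the words of permutations are n! distinct rearrangements of [iota 0 n], hence all
    of them. *)
Lemma wordP n w : perm_eq w (iota 0 n) -> exists pi : 'S_n, w = word pi.
Proof.
rewrite -mem_permutations.
have [|||_ E] := @uniq_min_size _ [seq word pi | pi <- enum {: 'S_n}]
   (permutations (iota 0 n)).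
- by rewrite map_inj_uniq ?enum_uniq //; exact: word_inj.
- by move=> u /mapP[pi _ ->]; rewrite mem_permutations word_perm.
- rewrite size_map -cardE card_Sn size_permutations ?iota_uniq //.
  by rewrite size_iota.
by rewrite -E => /mapP[pi _ ->]; exists pi.
Qed.

Lemma avoids213P n (pi : 'S_n) : reflect (avoids213_seq (word pi)) (avoids213 pi).
Proof.
apply: (iffP idP) => [/existsPn A p q r pq qr|A].
  rewrite size_word => rn; have qn := ltn_trans qr rn; have pn := ltn_trans pq qn.
  have /existsPn /(_ (Ordinal qn)) /existsPn /(_ (Ordinal rn)) /= :=
    A (Ordinal pn).
  by rewrite pq qr /= -!nth_word.
apply/existsPn => p; apply/existsPn => q; apply/existsPn => r.
apply/negP => /and4P[pq qr h1 h2].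
have := A p q r pq qr; rewrite size_word !nth_word h1 h2 => /(_ (ltn_ord r)) //.
Qed.

Definition words n := [seq word pi | pi <- enum (Av213 n)].

Lemma wordsP n w : reflect (av_words n w) (w \in words n).
Proof.
apply: (iffP mapP) => [[pi]|[P A]].
  rewrite mem_enum inE => /avoids213P A ->; split=> //; exact: word_perm.
have [pi E] := wordP P; exists pi => //.
by rewrite mem_enum inE; apply/avoids213P; rewrite -E.
Qed.

Lemma words_uniq n : uniq (words n).
Proof. by rewrite map_inj_uniq ?enum_uniq //; exact: word_inj. Qed.

(** Reindexing along the bijection [join_words]; the index [p] is determined as the size of the
    first part. *)
Lemma sum_words_recl n (f : seq nat -> nat) :
  \sum_(w <- words n.+1) f w =
  \sum_(p < n.+1) \sum_(s <- words p) \sum_(t <- words (n - p))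
     f (join_words s t).
Proof.
pose T (p : nat) := [seq (s, t) | s <- words p, t <- words (n - p)].
have P : perm_eq (words n.+1)
   [seq join_words st.1 st.2 | p <- iota 0 n.+1, st <- T p].
  apply: uniq_perm; first exact: words_uniq.
    apply: allpairs_uniq_dep; first exact: iota_uniq.
      move=> p _; apply: allpairs_uniq; try exact: words_uniq.
      by move=> [a b] [c d] _ _ /= [-> ->].
    move=> _ _ /allpairsPdep[p [st [_ h ->]]] /allpairsPdep[p' [st' [_ h' ->]]] /=.
    move: st st' h h' => [s t] [s' t'] /allpairsP[[s1 t1] /= [S1 _ [-> ->]]].
    move=> /allpairsP[[s2 t2] /= [S2 _ [-> ->]]] /join_words_inj[e1 e2].
    move: S1 S2; rewrite e1 e2 => /wordsP/av_words_size <- /wordsP/av_words_size <-.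
    by [].
  move=> w; apply/wordsP/allpairsPdep => [/av_words_split[s [t [sn ws wt ->]]]|].
    exists (size s), (s, t); split=> //; first by rewrite mem_iota add0n ltnS.
    by apply: allpairs_f; apply/wordsP.
  case=> p [[s t] [pn /allpairsP[[s' t'] /= [/wordsP ws /wordsP wt [-> ->]]]]] ->.
  have := av_words_join ws wt; rewrite subnKC //.
  by move: pn; rewrite mem_iota ltnS.
rewrite (perm_big _ P) big_allpairs_dep -[iota 0 n.+1]/(index_iota 0 n.+1) /=.
rewrite big_mkord; apply: eq_bigr => p _.
by rewrite /T big_allpairs_dep.
Qed.

(** * Vertices of degree 4, column by column *)

(** The conditions express that the upper, lower, left and right neighbours all exist. The bounds on
    [v.1] keep [v.1.-1] and [v.1.+1] from meaning a wrong column or a default letter. *)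
Lemma grid_deg4E n (pi : 'S_n) (v : 'I_n * 'I_n) : v \in grid_vertices pi ->
  (grid_deg pi v == 4) =
  [&& v.2 < pi v.1, 0 < v.2, 0 < v.1, v.1.+1 < n,
      v.2 <= nth 0 (word pi) v.1.-1 & v.2 <= nth 0 (word pi) v.1.+1].
Proof.
case: v => i j; rewrite inE /= => ji.
pose N := [set w in grid_vertices pi | grid_adj (i, j) w].
(* The four directions are injectively coded by (same column?, increasing?), so
   degree 4 means that every code is attained. *)
pose dir (w : 'I_n * 'I_n) := (i == w.1, (i < w.1) || (j < w.2)).
have NE (w : 'I_n * 'I_n) : w \in N = (w.2 <= pi w.1) && grid_adj (i, j) w by rewrite !inE.
have dinj : {in N &, injective dir}.
  move=> [a b] [c d]; rewrite !NE /grid_adj /dir /= -!(inj_eq val_inj) /=.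
  move=> /andP[_ h1] /andP[_ h2] [e1 e2].
  by congr (_, _); apply/val_inj => /=; lia.
have -> : (grid_deg pi (i, j) == 4) = (dir @: N == setT).
  rewrite /grid_deg -/N -(card_in_imset dinj) eqEcard subsetT /=.
  rewrite cardsT card_prod card_bool eqn_leq andbC -[2 * 2]/4.
  have := max_card (mem (dir @: N)).
  by rewrite card_prod card_bool => ->; rewrite andbT.
have adjE a b : grid_adj (i, j) (a, b) =
    (i == a :> nat) && (`|j - b| == 1) || (`|i - a| == 1) && (j == b :> nat) by [].
apply/eqP/idP => [E|/and5P[jpi j0 i0 iN /andP[jl jr]]].
  have ex d : exists a b : 'I_n, [/\ b <= pi a, grid_adj (i, j) (a, b) & d = dir (a, b)].
    have : d \in dir @: N by rewrite E inE.
    by case/imsetP => -[a b]; rewrite NE => /andP[h1 h2] ->; exists a, b.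
  have dE (a b : 'I_n) : dir (a, b) = (i == a :> nat, (i < a) || (j < b)) by [].
  (* The codes [(true, true)], [(true, false)], [(false, false)], [(false, true)] stand for up,
     down, left, right. *)
  apply/and5P; split.
  - have [a [b []]] := ex (true, true); rewrite adjE dE => h1 h2 [/esym/eqP/val_inj ia h3].
    by move: h1 h3; rewrite -ia ltnn /= => h1 h3; apply: leq_trans h1.
  - have [a [b []]] := ex (true, false); rewrite adjE dE => _ h2 []; lia.
  - have [a [b []]] := ex (false, false); rewrite adjE dE => _ h2 []; lia.
  - have [a [b []]] := ex (false, true); rewrite adjE dE => _ h2 [] h3 h4.
    have := ltn_ord a; lia.
  - apply/andP; split.
      have [a [b []]] := ex (false, false); rewrite adjE dE => h1 h2 [] h3 h4.
      have -> : i.-1 = a by lia.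
      by rewrite nth_word; lia.
    have [a [b []]] := ex (false, true); rewrite adjE dE => h1 h2 [] h3 h4.
    have -> : i.+1 = a by lia.
    by rewrite nth_word; lia.
apply/eqP; rewrite eqEsubset subsetT; apply/subsetP => d _.
have wit (a b : 'I_n) : b <= pi a -> grid_adj (i, j) (a, b) -> d = dir (a, b) -> d \in dir @: N.
  by move=> h1 h2 ->; apply: imset_f; rewrite NE h1.
have jN : j.+1 < n by apply: leq_ltn_trans jpi _.
have jP : j.-1 < n by lia.
have iP : i.-1 < n by lia.
have dE (a b : 'I_n) : dir (a, b) = (i == a :> nat, (i < a) || (j < b)) by [].
case: d wit => -[] [] wit.
- by apply: (wit i (Ordinal jN)) => //; rewrite ?adjE ?dE /=; [lia|congr (_, _); lia].
- by apply: (wit i (Ordinal jP)) => //; rewrite ?adjE ?dE /=; [lia|lia|congr (_, _); lia].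
- apply: (wit (Ordinal iN) j); rewrite ?adjE ?dE /=; [|lia|congr (_, _); lia].
  by rewrite -nth_word.
- apply: (wit (Ordinal iP) j); rewrite ?adjE ?dE /=; [|lia|congr (_, _); lia].
  by rewrite -nth_word.
Qed.

Lemma sum1_pos_le n k : \sum_(j < n | 0 < j <= k) 1 = minn k n.-1.
Proof.
elim: n => [|n IH]; first by rewrite big_ord0 minn0.
by rewrite big_mkcond big_ord_recr -big_mkcond IH /=; case: ifP; lia.
Qed.

Lemma card_grid_deg4 n (pi : 'S_n) :
  #|[set v in grid_vertices pi | grid_deg pi v == 4]| = triple_sum min3 (word pi).
Proof.
pose m i := min3 (nth 0 (word pi) i.-1) (nth 0 (word pi) i) (nth 0 (word pi) i.+1).
transitivity (\sum_(i < n) (0 < i) * (i.+1 < n) * m i).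
  rewrite -sum1_card (eq_bigl (fun v : 'I_n * 'I_n =>
     true && ([&& 0 < v.1, v.1.+1 < n & 0 < v.2 <= m v.1]))); last first.
    move=> [i j]; rewrite inE.
    case: (boolP ((i, j) \in grid_vertices pi)) => [V|]; last first.
      rewrite inE /= /m /min3 nth_word; lia.
    rewrite (grid_deg4E V) /m /min3 /= nth_word; lia.
  rewrite -(pair_big_dep xpredT (fun i j : 'I_n => [&& 0 < i, i.+1 < n & 0 < j <= m i])
     (fun _ _ => 1)) /=.
  apply: eq_bigr => i _.
  case: (0 < i) => /=; last by rewrite big_pred0.
  case: (i.+1 < n) => /=; last by rewrite big_pred0.
  (* The heights 1, ..., [m i] all fit below [n], so the cap [n.-1] in [sum1_pos_le] has no
     effect. *)
  have mn : m i < n by rewrite /m /min3 nth_word; have := ltn_ord (pi i); lia.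
  by rewrite mul1n sum1_pos_le; lia.
rewrite triple_sum_nth size_word.
case: n pi @m => [|[|n]] pi m; rewrite ?big_ord0 ?big_ord1 //.
(* The first and last columns contribute 0; the remaining columns are the middles of the triples. *)
rewrite subSS subSS subn0 big_ord_recl big_ord_recr /= ltnn muln0 addn0 add0n.
by apply: eq_bigr => i _; rewrite /m /bump /= !add1n !ltnS ltn_ord !mul1n.
Qed.

(** * Recurrences for the number of words and the summed statistics *)

Lemma sum_seq_const (T : Type) (r : seq T) k : \sum_(s <- r) k = size r * k.
Proof. by rewrite big_const_seq count_predT iter_addn_0 mulnC. Qed.

Lemma size_words_rec n :
  size (words n.+1) = \sum_(p < n.+1) size (words p) * size (words (n - p)).
Proof.
rewrite -sum1_size sum_words_recl; apply: eq_bigr => p _.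
by under eq_bigr do rewrite sum_seq_const muln1; rewrite sum_seq_const.
Qed.

Definition sum_min3S n := \sum_(w <- words n) triple_sum min3S w.

Lemma Q4_words n : Q4 n = \sum_(w <- words n) triple_sum min3 w.
Proof.
rewrite /words big_map big_enum.
by apply: eq_bigr => pi _; rewrite card_grid_deg4.
Qed.

Lemma Q4_rec n : Q4 n.+1 = \sum_(p < n.+1)
  (sum_min3S p * size (words (n - p))
   + (n - p) * (p - 2) * (size (words p) * size (words (n - p)))
   + sum_min3S (n - p) * size (words p)).
Proof.
rewrite Q4_words sum_words_recl; apply: eq_bigr => p _.
transitivity (\sum_(s <- words p) \sum_(t <- words (n - p))
   (triple_sum min3S s + ((n - p) * (p - 2) + triple_sum min3S t))).
  apply: eq_big_seq => s /wordsP/av_words_size ss.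
  apply: eq_big_seq => t /wordsP/av_words_size st.
  by rewrite triple_sum_join ss st addnA.
under eq_bigr do rewrite big_split sum_seq_const big_split sum_seq_const /=.
rewrite big_split sum_seq_const /= -big_distrr /= /sum_min3S; lia.
Qed.

Definition inner_zero_count n := \sum_(w <- words n) inner_zeros w.

Lemma sum_min3S_Q4 n :
  Q4 n + (n - 2) * size (words n) = sum_min3S n + inner_zero_count n.
Proof.
rewrite Q4_words mulnC -sum_seq_const -!big_split /=.
by apply: eq_big_seq => w /wordsP/av_words_size sw; rewrite -triple_sum_min3S sw.
Qed.

Lemma inner_zero_count_rec n : inner_zero_count n.+1 =
  \sum_(p < n.+1) (0 < p) * (0 < n - p) * (size (words p) * size (words (n - p))).
Proof.
rewrite /inner_zero_count sum_words_recl; apply: eq_bigr => p _.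
transitivity (\sum_(s <- words p) \sum_(t <- words (n - p)) ((0 < p) && (0 < n - p) : nat)).
  apply: eq_big_seq => s /wordsP/av_words_size ss.
  apply: eq_big_seq => t /wordsP/av_words_size st.
  by rewrite inner_zeros_join -st -ss !lt0n !size_eq0.
rewrite !sum_seq_const mulnb; lia.
Qed.

Lemma size_words0 : size (words 0) = 1.
Proof.
apply/eqP; rewrite eqn_leq; apply/andP; split.
  rewrite -[1]/(size [:: [::] : seq nat]); apply: uniq_leq_size; first exact: words_uniq.
  by move=> w /wordsP/av_words_size/eqP; rewrite size_eq0 inE.
rewrite -has_predT; apply/hasP; exists [::] => //.
by apply/wordsP; split=> // p q r _ _; rewrite ltn0.
Qed.

(** * Convolutions of Catalan and central binomial sequences *)

Import GRing.Theory Num.Theory.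
Local Open Scope ring_scope.

(** Cauchy product: the coefficient of x^n in the product of the generating functions of [f] and
    [g]. *)
Definition conv (f g : nat -> rat) n : rat := \sum_(k < n.+1) f k * g (n - k)%N.

Lemma eq_conv f f' g n : f =1 f' -> conv f g n = conv f' g n.
Proof. by move=> e; apply: eq_bigr => k _; rewrite e. Qed.

Lemma convC f g n : conv f g n = conv g f n.
Proof.
rewrite /conv (reindex_inj rev_ord_inj) /=; apply: eq_bigr => k _.
by rewrite subSS subKn -1?ltnS // mulrC.
Qed.

Lemma convDl f f' g n : conv (fun k => f k + f' k) g n = conv f g n + conv f' g n.
Proof. by rewrite -big_split; apply: eq_bigr => k _; rewrite mulrDl. Qed.

Lemma convZl a f g n : conv (fun k => a * f k) g n = a * conv f g n.
Proof. by rewrite /conv mulr_sumr; apply: eq_bigr => k _; rewrite mulrA. Qed.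

Lemma convSl f g n : conv f g n.+1 = f 0%N * g n.+1 + conv (fun k => f k.+1) g n.
Proof. by rewrite /conv big_ord_recl subn0. Qed.

Lemma conv_delta0 g n : conv (fun k => (k == 0%N)%:R) g n = g n.
Proof. by rewrite /conv big_ord_recl subn0 mul1r big1 ?addr0 // => i _; rewrite mul0r. Qed.

Lemma conv_delta1 g n : conv (fun k => (k == 1%N)%:R) g n.+1 = g n.
Proof. by rewrite convSl mul0r add0r -[RHS]conv_delta0. Qed.

(* k and n - k play symmetric roles in f_k f_(n-k). *)
Lemma conv_index f n : conv (fun k => k%:R * f k) f n = n%:R / 2 * conv f f n.
Proof.
suff: conv (fun k => k%:R * f k) f n + conv (fun k => k%:R * f k) f n
      = n%:R * conv f f n by lra.
rewrite {2}convC /conv -big_split mulr_sumr; apply: eq_bigr => k _ /=.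
have /natrB -> : (k <= n)%N by rewrite -ltnS.
ring.
Qed.

Definition cbin n : rat := 'C(2 * n, n)%:R.
Definition catalan n : rat := cbin n / n.+1%:R.

Lemma cbin_catalan n : cbin n = n.+1%:R * catalan n.
Proof. by rewrite /catalan mulrC divfK // pnatr_eq0. Qed.

(** Two absorption identities lead from C(2n+2, n+1) to C(2n+1, n) and then to C(2n, n). *)
Lemma cbin_rec n : n.+1%:R * cbin n.+1 = (4 * n%:R + 2) * cbin n.
Proof.
have E : (n.+1 * 'C(2 * n.+1, n.+1) = (4 * n + 2) * 'C(2 * n, n))%N.
  have h1 := mul_bin_diag (2 * n.+1) n.
  have h2 := mul_bin_down (2 * n).+1 n.
  rewrite -h1; apply/eqP; rewrite -(eqn_pmul2l (ltn0Sn n)); apply/eqP.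
  have e : (2 * n.+1).-1 = (2 * n).+1 by lia.
  have e' : ((2 * n).+1 - n = n.+1)%N by lia.
  rewrite e' /= in h2; rewrite e mulnCA -h2 !mulnA; congr (_ * _)%N; lia.
by rewrite /cbin -natrM E natrM natrD natrM.
Qed.

Lemma catalan_rec n : n.+2%:R * catalan n.+1 = (4 * n%:R + 2) * catalan n.
Proof.
have := cbin_rec n; rewrite !cbin_catalan => e.
apply: (mulfI (x := n.+1%:R)); first by rewrite pnatr_eq0.
by rewrite e mulrCA.
Qed.

Lemma catalanS n : catalan n.+1 = (4 * n%:R + 2) / (n%:R + 2) * catalan n.
Proof.
have n0 : 0 <= n%:R :> rat by [].
have d0 : n%:R + 2 != 0 :> rat by apply/lt0r_neq0; lra.
by rewrite mulrAC -catalan_rec; field.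
Qed.

Lemma catalan0 : catalan 0 = 1. Proof. by rewrite /catalan /cbin bin0 divr1. Qed.
Lemma cbin0 : cbin 0 = 1. Proof. by rewrite /cbin bin0. Qed.

(** Segner's recurrence. The sum of (k+1) c_k c_(m-k) at m = n+1 is evaluated twice: by symmetry it
    is m/2 + 1 times the convolution at m; after splitting off k = 0, [catalan_rec] reduces it to
    the convolution at n. *)
Lemma conv_catalan_catalan n : conv catalan catalan n = catalan n.+1.
Proof.
have shift m : conv (fun k => (k.+1)%:R * catalan k) catalan m = (m%:R / 2 + 1) * conv catalan catalan m.
  rewrite mulrDl mul1r -conv_index -convDl; apply: eq_conv => k.
  by rewrite -natr1 mulrDl mul1r.
elim: n => [|n IH].
  by have := catalan_rec 0; rewrite /conv big_ord1 subn0 catalan0; lra.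
have := shift n.+1; rewrite convSl catalan0.
rewrite (eq_conv _ _ (f' := fun k => 4 * (k%:R * catalan k) + 2 * catalan k)); last first.
  by move=> k; rewrite catalan_rec mulrDl mulrA.
rewrite convDl !convZl conv_index IH => e.
have h := catalan_rec n.+1; have n0 : 0 <= n%:R :> rat by [].
apply: (mulfI (x := n%:R + 3)); first by apply/lt0r_neq0; lra.
lra.
Qed.

Lemma conv_cbin_catalan n : conv cbin catalan n = cbin n.+1 / 2.
Proof.
rewrite (eq_conv _ _ (f' := fun k => k%:R * catalan k + catalan k)); last first.
  by move=> k; rewrite cbin_catalan -natr1 mulrDl mul1r.
rewrite convDl conv_index conv_catalan_catalan cbin_catalan; lra.
Qed.

(** The same double evaluation, now with weight k and [cbin_rec]. *)
Lemma conv_cbin_cbin n : conv cbin cbin n = 4 ^+ n.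
Proof.
elim: n => [|n IH]; first by rewrite /conv big_ord1 subn0 cbin0 expr0 mulr1.
have := conv_index cbin n.+1; rewrite convSl !mul0r add0r.
rewrite (eq_conv _ _ (f' := fun k => 4 * (k%:R * cbin k) + 2 * cbin k)); last first.
  by move=> k; rewrite cbin_rec mulrDl mulrA.
rewrite convDl !convZl conv_index IH exprS => e.
have n0 : 0 <= n%:R :> rat by [].
apply: (mulfI (x := n%:R + 1)); first by apply/lt0r_neq0; lra.
lra.
Qed.

Lemma conv_exp4_catalan n : conv (fun k => 4 ^+ k) catalan n = (4 ^+ n.+1 - cbin n.+1) / 2.
Proof.
elim: n => [|n IH].
  rewrite /conv big_ord1 subn0 catalan0 !expr0.
  by have := cbin_rec 0; rewrite cbin0; lra.
rewrite convSl (eq_conv _ _ (f' := fun k => 4 * 4 ^+ k)); last by move=> k; rewrite exprS.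
rewrite convZl IH.
have := catalan_rec n.+1; rewrite !cbin_catalan ![4 ^+ _.+1]exprS expr0; lra.
Qed.

(** The right-hand side is (n+1)/2 B_(n+1) - 4^n. By [cbin_rec], the value at n+1 is 4 times the
    value at n plus twice [conv cbin catalan n]. *)
Lemma conv_index_cbin_catalan n : conv (fun k => k%:R * cbin k) catalan n =
   ((2 * n%:R + 3) * cbin n.+1 - 4 ^+ n.+1) / 4 - cbin n.+1 / 4.
Proof.
elim: n => [|n IH].
  rewrite /conv big_ord1 subn0 catalan0 !mul0r.
  by have := cbin_rec 0; rewrite cbin0; lra.
rewrite convSl !mul0r add0r.
rewrite (eq_conv _ _ (f' := fun k => 4 * (k%:R * cbin k) + 2 * cbin k)); last first.
  by move=> k; rewrite cbin_rec mulrDl mulrA.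
rewrite convDl !convZl IH conv_cbin_catalan.
have := cbin_rec n.+1; rewrite ![4 ^+ _.+1]exprS; lra.
Qed.

(** The coefficients of -sqrt(1 - 4x); the value at 0 is -1. *)
Definition cbin_odd n : rat := cbin n / (2 * n%:R - 1).

Lemma cbin_oddS n : cbin_odd n.+1 = 2 * catalan n.
Proof.
rewrite /cbin_odd; have := cbin_rec n; rewrite (cbin_catalan n) => e.
have n0 : 0 <= n%:R :> rat by [].
have d0 : 2 * n.+1%:R - 1 != 0 :> rat by apply/lt0r_neq0; lra.
apply: (mulIf d0); rewrite divfK //.
apply: (mulfI (x := n%:R + 1)); first by apply/lt0r_neq0; lra.
lra.
Qed.

Lemma conv_cbin_odd_catalan n : conv cbin_odd catalan n.+1 = catalan n.+1.
Proof.
rewrite convSl (eq_conv _ _ cbin_oddS) convZl conv_catalan_catalan /cbin_odd cbin0 mulr0 sub0r invrN1; lra.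
Qed.

(** * Solution of the recurrence *)

Lemma size_words_catalan n : (size (words n))%:R = catalan n.
Proof.
elim/ltn_ind: n => -[|n] IH; first by rewrite size_words0 catalan0.
rewrite size_words_rec natr_sum -conv_catalan_catalan; apply: eq_bigr => p _.
by rewrite natrM !IH // ltnS ?leq_subr // -ltnS.
Qed.

(** The solution X(n). The last two terms correct the values at n = 0 and n = 1 to 0, as words with
    fewer than three letters have no triple. *)
Definition sum_min3S_closed n : rat :=
  n%:R / 2 * cbin n - cbin n / 8 + catalan n - cbin_odd n / 8 - 7 / 16 * 4 ^+ n
  - 9 / 16 * (n == 0%N)%:R + 1 / 4 * (n == 1%N)%:R.

Lemma conv_sum_min3S_closed n : conv sum_min3S_closed catalan n.+1 =
  (8 * n%:R + 21) / 32 * cbin n.+2 - 11 / 8 * 4 ^+ n.+1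
  + catalan n.+2 - 11 / 16 * catalan n.+1 + 1 / 4 * catalan n.
Proof.
rewrite (eq_conv (f' := fun k => 1 / 2 * (k%:R * cbin k) + -1 / 8 * cbin k + catalan k
  + -1 / 8 * cbin_odd k + -7 / 16 * 4 ^+ k
  + -9 / 16 * (k == 0%N)%:R + 1 / 4 * (k == 1%N)%:R)); last first.
  by move=> k; rewrite /sum_min3S_closed; lra.
rewrite !convDl !convZl conv_index_cbin_catalan conv_cbin_catalan conv_catalan_catalan.
rewrite conv_cbin_odd_catalan conv_exp4_catalan conv_delta0 conv_delta1 !exprS.
lra.
Qed.

Lemma sum_cross_terms n :
  (\sum_(p < n.+2) (n.+1 - p) * (p - 2) *
     (size (words p) * size (words (n.+1 - p))))%N%:R =
  4 ^+ n.+1 - 2 * cbin n.+2 + 3 * catalan n.+2 + 2 * (cbin n.+1 - catalan n.+1)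
  + (cbin n - catalan n).
Proof.
(* From p c_p = B_p - c_p comes (p-2) c_p = B_p - 3 c_p; the terms at 0 and 1 account for the
   truncation of [p - 2]. *)
pose f p : rat := 1 * cbin p + - 3 * catalan p + (2 * (p == 0%N)%:R + 1 * (p == 1%N)%:R).
have fE p : (p - 2)%N%:R * catalan p = f p.
  rewrite /f; case: p => [|[|p]].
  - rewrite sub0n catalan0 cbin0 /=; lra.
  - by have := catalan_rec 0; rewrite -[(1 - 2)%N]/0%N catalan0 cbin_catalan /=; lra.
  - rewrite subSS subSS subn0 cbin_catalan /=; lra.
pose g p : rat := cbin p + -1 * catalan p.
have gE p : p%:R * catalan p = g p by rewrite /g cbin_catalan; lra.
transitivity (conv f g n.+1).
  rewrite natr_sum; apply: eq_bigr => p _.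
  rewrite -fE -gE !natrM !size_words_catalan; ring.
rewrite !convDl !convZl conv_delta0 conv_delta1 (convC cbin) (convC catalan).
rewrite !convDl !convZl conv_cbin_cbin conv_catalan_catalan (convC catalan) conv_cbin_catalan /g.
lra.
Qed.

Lemma sum_min3S_small n : (n < 2)%N -> sum_min3S n = 0%N.
Proof.
move=> n2; rewrite /sum_min3S big1_seq // => w /andP[_ /wordsP/av_words_size sw].
by rewrite triple_sum_nth sw big1 // => -[i /=]; lia.
Qed.

(** Both parts of a word contribute the same total, by the symmetry of the convolution. *)
Lemma Q4_conv n : (Q4 n.+1)%:R = 2 * conv (fun p => (sum_min3S p)%:R) catalan n +
  (\sum_(p < n.+1) (n - p) * (p - 2) *
     (size (words p) * size (words (n - p))))%N%:R.
Proof.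
have E : conv (fun p => (sum_min3S p)%:R) catalan n =
    (\sum_(p < n.+1) sum_min3S p * size (words (n - p)))%N%:R.
  by rewrite natr_sum; apply: eq_bigr => p _; rewrite natrM size_words_catalan.
have E' : conv (fun p => (sum_min3S p)%:R) catalan n =
    (\sum_(p < n.+1) sum_min3S (n - p) * size (words p))%N%:R.
  by rewrite convC natr_sum; apply: eq_bigr => p _; rewrite natrM size_words_catalan mulrC.
rewrite Q4_rec !big_split !natrD -E -E' /=; ring.
Qed.

(** Of the c_(n+2) words, c_(n+1) begin with 0 and c_(n+1) end with it. The sequence [f] is
    [catalan] without its value at 0, which forces both parts to be nonempty. *)
Lemma inner_zero_count_closed n :
  (inner_zero_count n.+2)%:R = catalan n.+2 - 2 * catalan n.+1.
Proof.
pose f p : rat := catalan p + -1 * (p == 0%N)%:R.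
have fE p : (0 < p)%N%:R * catalan p = f p.
  by rewrite /f; case: p => [|p] /=; rewrite ?catalan0; lra.
transitivity (conv f f n.+1).
  rewrite inner_zero_count_rec natr_sum; apply: eq_bigr => p _.
  rewrite -!fE !natrM !size_words_catalan; ring.
rewrite convDl convZl conv_delta0 convC convDl convZl conv_delta0 conv_catalan_catalan /f /=.
lra.
Qed.

(** Strong induction: the recurrence for X(n+2) involves X only at indices up to n+1. *)
Lemma sum_min3SE n : (sum_min3S n)%:R = sum_min3S_closed n.
Proof.
elim/ltn_ind: n => -[|[|n]] IH.
- by rewrite sum_min3S_small.
- by rewrite sum_min3S_small.
have := congr1 (fun k => k%:R : rat) (sum_min3S_Q4 n.+2).
rewrite /= !natrD natrM size_words_catalan inner_zero_count_closed Q4_conv sum_cross_terms.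
have -> : conv (fun p => (sum_min3S p)%:R) catalan n.+1 = conv sum_min3S_closed catalan n.+1.
  by apply: eq_bigr => p _; rewrite IH.
rewrite conv_sum_min3S_closed subSS subSS subn0 /sum_min3S_closed cbin_oddS /=.
rewrite /sum_min3S_closed !cbin_catalan !catalanS !exprS => E.
have n0 : 0 <= n%:R :> rat by [].
(* With the inner-zero count added to both sides, the left side is the one computed in [E]. *)
apply: (addIr (catalan n.+2 - 2 * catalan n.+1)).
rewrite !catalanS -E; field; rewrite !lt0r_neq0 //; lra.
Qed.

Theorem theorem7p2 (n : nat) (hn : (2 <= n)%N) :
  (Q4 n)%:R =
    (4 * n%:R ^+ 3 - 7 * n%:R ^+ 2 + 29 * n%:R - 20)
      / (4 * (n%:R + 1) * (2 * n%:R - 1)) * 'C(2 * n, n)%:R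
    - 7 * 4 ^+ (n - 2) :> rat.
Proof.
case: n hn => [|[|n]] // _.
rewrite Q4_conv sum_cross_terms.
have -> : conv (fun p => (sum_min3S p)%:R) catalan n.+1 = conv sum_min3S_closed catalan n.+1.
  by apply: eq_conv => p; rewrite sum_min3SE.
(* Everything becomes a rational function of n times [catalan n], plus a multiple of [4 ^+ n]. *)
rewrite conv_sum_min3S_closed -/(cbin n.+2) subSS subSS subn0 !cbin_catalan !catalanS !exprS.
have n0 : 0 <= n%:R :> rat by [].
field; rewrite !lt0r_neq0 //; lra.
Qed.
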